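(* For every integer $g$ satisfying $3 \le g \le 16$ there exists a platypus of girth $g$.
   Context: Graphs are finite and simple, with at least three vertices. A graph is hamiltonian (traceable) if it contains a spanning cycle (spanning path). A platypus is a non-hamiltonian graph $G$ such that for every vertex $v$ of $G$ the vertex-deleted subgraph $G-v$ is traceable. The girth of a graph is the length of a shortest cycle in it. *)

(* Defs.v *)
From mathcomp Require Import all_boot.

Set Implicit Arguments.
Unset Strict Implicit.
Unset Printing Implicit Defensive.

Record sgraph := SGraph {
  vertex :> finType;
  adj : rel vertex;
  adj_sym : symmetric adj;
  adj_irrefl : irreflexive adj
}.

Section Deletion.
Variables (G : sgraph) (v : G).

Definition del_vertex_adj : rel {x : G | x != v} :=
  fun x y => adj (val x) (val y).

Lemma del_vertex_adj_sym : symmetric del_vertex_adj.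
Proof. by move=> x y; rewrite /del_vertex_adj adj_sym. Qed.

Lemma del_vertex_adj_irrefl : irreflexive del_vertex_adj.
Proof. by move=> x; rewrite /del_vertex_adj adj_irrefl. Qed.

Definition del_vertex : sgraph :=
  SGraph del_vertex_adj_sym del_vertex_adj_irrefl.

End Deletion.

Section Notions.
Variable G : sgraph.

(* [ucycle] alone also accepts the empty sequence and, because an edge can be
   traversed back and forth, sequences of size 2; neither is a graph cycle. *)
Definition is_cycle (c : seq G) : Prop := 3 <= size c /\ ucycle (@adj G) c.

(* A nonempty path is given by its first vertex x and the remaining ones p. *)
Definition is_path (x : G) (p : seq G) : Prop :=
  path (@adj G) x p /\ uniq (x :: p).

Definition hamiltonian : Prop :=
  exists c : seq G, is_cycle c /\ forall x : G, x \in c.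

Definition traceable : Prop :=
  exists (x : G) (p : seq G), is_path x p /\ forall y : G, y \in x :: p.

(* Holds for no g when G is acyclic (infinite girth). *)
Definition has_girth (g : nat) : Prop :=
  (exists c : seq G, is_cycle c /\ size c = g) /\
  (forall c : seq G, is_cycle c -> g <= size c).

End Notions.

(* The bound on the number of vertices is the standing assumption on graphs;
   it is imposed here rather than in [sgraph] because G - v may have only two
   vertices. *)
Definition platypus (G : sgraph) : Prop :=
  [/\ 3 <= #|G|, ~ hamiltonian G & forall v : G, traceable (del_vertex v)].

(* Main.v *)
(* Replace every vertex of the Petersen graph by a copy of G - 1, where G is a
   cubic Cayley graph of girth g, so that the three neighbours of 1 become the
   ports carrying the three Petersen edges.  A cycle leaving a copy of G - 1 runs
   from port to port, which costs at least g - 1 vertices, so the girth stays g.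
   A Hamiltonian cycle meets each three-edge cut around a copy exactly twice, so
   it would contract to a Hamiltonian cycle of the Petersen graph.  After deleting
   a vertex v of some copy, a Hamiltonian cycle of G - v is cut open at 1 into a
   path ending in a port, and continues along a Hamiltonian path of the Petersen
   graph, provided the ports of G - 1 are pairwise joined by Hamiltonian paths.
   By vertex transitivity one Hamiltonian cycle of G and one of G - 1 supply all
   these paths; they were found by a randomised search. *)
From Stdlib Require Import String Ascii.
Require Import Defs.
From mathcomp Require Import all_boot all_fingroup.

Set Implicit Arguments.
Unset Strict Implicit.
Unset Printing Implicit Defensive.

(** * Inflating a cubic graph *)

Definition spans (G : sgraph) (x : G) (p : seq G) : Prop :=
  is_path x p /\ forall y, y \in x :: p.

(* [(size p).+2] is the length of the cycle closed up through a vertex joined to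
   all the ports. *)
Definition fragment (g : nat) (H : sgraph) (port : 'I_3 -> H) : Prop :=
  [/\ injective port, has_girth H g,
      forall k l p, k != l -> is_path (port k) p -> last (port k) p = port l ->
        g <= (size p).+2,
      forall k l, k != l ->
        exists2 p, spans (port k) p & last (port k) p = port l
    & forall v, exists x p k, [/\ is_path x p, last x p = port k
        & forall y, (y \in x :: p) = (y != v)]].

(** * Passing between a graph and its vertex-deleted subgraphs *)

Section LiftDel.
Variables (G : sgraph) (v : G).

Lemma lift_del_seq (s : seq G) :
  v \notin s -> exists q : seq (del_vertex v), map val q = s.
Proof.
elim: s => [|y s IH]; first by exists [::].
rewrite inE eq_sym negb_or => /andP[yv /IH[q <-]].
by exists (Sub y yv :: q).
Qed.

Lemma lift_del_path (x : del_vertex v) (p : seq G) :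
  is_path (val x) p -> v \notin p ->
  exists2 q, map val q = p & @is_path (del_vertex v) x q.
Proof.
move=> [px ux] /lift_del_seq[q qp]; exists q => //; split.
  by rewrite -qp path_map in px.
by rewrite -(map_inj_uniq val_inj) /= qp.
Qed.

Lemma lift_del_cycle (c : seq G) :
  is_cycle c -> v \notin c ->
  exists2 q, map val q = c & @is_cycle (del_vertex v) q.
Proof.
move=> [c3 /andP[cc uc]] /lift_del_seq[q qc]; exists q => //.
rewrite -qc size_map in c3; split=> //.
rewrite -qc (map_inj_uniq val_inj) in uc; rewrite /ucycle uc andbT.
by move: cc; rewrite -qc; case: (q) => //= x p; rewrite -map_rcons path_map.
Qed.

Lemma is_cycle_del (c : seq (del_vertex v)) :
  is_cycle c -> @is_cycle G (map val c).
Proof.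
move=> [c3 /andP[cc uc]]; split; first by rewrite size_map.
rewrite /ucycle (map_inj_uniq val_inj) uc andbT.
by case: (c) cc => [|x p] //= cc; rewrite -map_rcons path_map.
Qed.

Lemma traceable_del (x : G) (p : seq G) :
  is_path x p -> (forall y, (y \in x :: p) = (y != v)) ->
  traceable (del_vertex v).
Proof.
move=> xp pv; have xv : x != v by rewrite -pv mem_head.
have vp : v \notin p by have := pv v; rewrite eqxx inE => /norP[].
have [q qp pq] := @lift_del_path (Sub x xv) p xp vp.
by exists (Sub x xv), q; split=> // y; rewrite -(mem_map val_inj) /= qp pv (valP y).
Qed.

End LiftDel.

(** * Rotations and successors on a cycle *)

Section CycleRotation.
Variable G : sgraph.

Lemma is_cycle_rot n (c : seq G) : is_cycle c -> is_cycle (rot n c).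
Proof. by move=> [s3 uc]; split; rewrite ?size_rot // /ucycle rot_cycle rot_uniq. Qed.

(** Length at least 3 keeps a cycle from running back along the edge it has just used; in an
    inflated graph this separates entries from exits. *)
Lemma is_cycle_next2 (c : seq G) x : is_cycle c -> x \in c -> next c (next c x) != x.
Proof.
move=> [s3 /andP[_ uc]] /rot_to [n q cq].
have sq : 2 <= size q by rewrite -ltnS -[(size q).+1]/(size (x :: q)) -cq size_rot.
rewrite -!(next_rot n uc); move: uc; rewrite -(rot_uniq n) {}cq.
case: q sq => [|y [|z q]] // _; rewrite [uniq _]/= !inE !negb_or.
by case/andP=> /and3P[xy xz _] _; rewrite /= !eqxx ![_ == x]eq_sym (negbTE xy).
Qed.

End CycleRotation.

Section Inflation.
Variables (B H : sgraph) (port : 'I_3 -> H) (lab : B -> B -> 'I_3).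
Hypothesis port_inj : injective port.
Hypothesis lab_inj : forall i j j', adj i j -> adj i j' -> lab i j = lab i j' -> j = j'.

(** Vertex [(i, x)] is the vertex [x] of the copy of [H] at [i]. The base edge from [i] to [j]
    becomes a single edge, attached to copy [i] at port [lab i j] and to copy [j] at port
    [lab j i]. *)
Definition inflate_adj : rel (B * H) := fun u v =>
  (u.1 == v.1) && adj u.2 v.2 ||
  [&& adj u.1 v.1, u.2 == port (lab u.1 v.1) & v.2 == port (lab v.1 u.1)].

Lemma inflate_adj_sym : symmetric inflate_adj.
Proof.
move=> u v; rewrite /inflate_adj eq_sym adj_sym [adj u.1 _]adj_sym.
by congr (_ || (_ && _)); rewrite andbC.
Qed.

Lemma inflate_adj_irrefl : irreflexive inflate_adj.
Proof. by move=> u; rewrite /inflate_adj eqxx !adj_irrefl. Qed.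

Definition inflate : sgraph := SGraph inflate_adj_sym inflate_adj_irrefl.

Lemma adj_inside (i : B) (x y : H) : @adj inflate (i, x) (i, y) = adj x y.
Proof. by rewrite /= /inflate_adj /= eqxx adj_irrefl orbF. Qed.

Lemma path_inside (i : B) (x : H) p :
  path (@adj inflate) (i, x) (map (pair i) p) = path (@adj H) x p.
Proof. by rewrite path_map; apply: eq_path => y z; exact: adj_inside. Qed.

Lemma inside_pairs (i : B) (c : seq inflate) :
  all (fun u => u.1 == i) c -> c = map (pair i) (map snd c).
Proof. by elim: c => [//|[j x] c IH] /= /andP[/eqP -> /IH {1}->]. Qed.

Lemma adj_across (u v : inflate) : u.1 != v.1 ->
  adj u v = [&& adj u.1 v.1, u.2 == port (lab u.1 v.1) & v.2 == port (lab v.1 u.1)].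
Proof. by rewrite /= /inflate_adj => /negbTE ->. Qed.

(* [u.2] determines the port, hence the neighbouring fragment. *)
Lemma across_inj (u v v' : inflate) :
  u.1 != v.1 -> u.1 != v'.1 -> adj u v -> adj u v' -> v = v'.
Proof.
move=> uv uv'; rewrite !adj_across //.
case/and3P=> a1 /eqP e1 /eqP f1 /and3P[a2 /eqP e2 /eqP f2].
have e : v.1 = v'.1 by apply: (lab_inj a1 a2); apply: port_inj; rewrite -e1.
by rewrite [v]surjective_pairing [v']surjective_pairing f1 f2 e.
Qed.

(** * Contracting a Hamiltonian cycle of the inflated graph to the base *)

Section NonHamiltonian.
Variable c : seq inflate.
Hypotheses (cc : is_cycle c) (cT : forall u, u \in c).

Let uc : uniq c. Proof. by case: cc => _ /andP[]. Qed.
Let out u := (next c u).1 != u.1.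

Let adj_next u : adj u (next c u).
Proof. by case: cc => _ /andP[ac _]; exact: next_cycle ac (cT u). Qed.

Let next_inj : injective (next c).
Proof. exact: can_inj (prev_next uc). Qed.

(** Recording the next copy at each crossing contracts a stretch of the cycle to a walk in the base;
    steps inside a copy contribute nothing. *)
Let trace (u : inflate) (p : seq inflate) : fpath (next c) u p ->
  let D := [seq (next c v).1 | v <- belast u p & out v] in
  [/\ path (@adj B) u.1 D, last u.1 D = (last u p).1
    & {subset map fst (u :: p) <= u.1 :: D}].
Proof.
elim: p u => [|v p IH] u /=; first by move=> _; split.
case/andP=> /eqP uv /IH [pv lv sv].
have a := adj_next u; rewrite /out; case: ifP => /= [/[dup] o| /negbFE/eqP e].
  rewrite eq_sym => /adj_across e; rewrite e uv in a; case/andP: a => a _.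
  rewrite uv a pv; split=> // w; rewrite inE => /predU1P[->|/sv w_in].
    exact: mem_head.
  by rewrite inE w_in orbT.
rewrite uv in e; rewrite -e; split=> // w.
by rewrite inE => /predU1P[->|/sv]; first exact: mem_head.
Qed.

(** The cycle enters a copy as often as it leaves it, each time at a different port. Three ports
    leave room for only one entry and one exit. *)
Let one_entry u v : out u -> out v -> (next c u).1 = (next c v).1 -> u = v.
Proof.
move=> ou ov e; set i := (next c u).1 in e.
pose F := [set w : inflate | w.1 == i].
pose E := [set w in F | out w].
pose N := [set w in F | (prev c w).1 != i].
have EN : #|E| = #|N|.
  (* Within copy [i], [next] carries the vertices that are not exits onto those that are not
     entries; being injective, it shows that exits and entries are equally many. *)
  have im : next c @: (F :\: E) = F :\: N.
    apply/setP => w; rewrite !inE; apply/imsetP/idP.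
      move=> [z]; rewrite !inE => /andP[nz /eqP zi] ->.
      rewrite zi eqxx /out zi /= negbK in nz; rewrite nz prev_next // zi eqxx //.
    case/andP=> nw wi; rewrite wi /= negbK in nw.
    exists (prev c w); rewrite ?next_prev // !inE nw /out next_prev //.
    by rewrite (eqP nw) wi.
  have sE : E \subset F by apply/subsetP => w; rewrite inE => /andP[].
  have sN : N \subset F by apply/subsetP => w; rewrite inE => /andP[].
  have h : #|F :\: E| = #|F :\: N| by rewrite -im card_imset.
  have := cardsID E F; rewrite -(cardsID N F) (setIidPr sE) (setIidPr sN) h.
  exact: addIn.
(* A vertex that is both entry and exit would have both its cycle neighbours across its single outer
   edge, so these would coincide. *)
have disj : [disjoint E & N].
  apply/pred0P => w /=; apply/negP; rewrite !inE.
  case/andP=> /andP[wi ow] /andP[_ pw].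
  have := is_cycle_next2 cc (cT (prev c w)); rewrite next_prev // => /eqP; apply.
  apply: (@across_inj w) => //; first by rewrite eq_sym.
    by rewrite (eqP wi) eq_sym.
  by rewrite adj_sym -{2}(next_prev uc w).
have ports : E :|: N \subset [set (i, port k) | k in 'I_3].
  apply/subsetP => w; rewrite !inE => /orP[] /andP[/eqP wi ow]; apply/imsetP.
    rewrite /out eq_sym in ow.
    have := adj_next w; rewrite (adj_across ow) => /and3P[_ /eqP w2 _].
    by exists (lab w.1 (next c w).1); rewrite // -w2 -wi -surjective_pairing.
  rewrite -wi in ow; have := adj_next (prev c w); rewrite next_prev //.
  rewrite (adj_across ow) => /and3P[_ _ /eqP w2].
  by exists (lab w.1 (prev c w).1); rewrite // -w2 -wi -surjective_pairing.
(* Twice the number of entries is at most 3. *)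
have N1 : #|N| <= 1.
  have := leq_trans (subset_leq_card ports) (leq_imset_card _ _).
  rewrite cardsU disjoint_setI0 // cards0 subn0 EN card_ord.
  by case: #|N| => [|[|n]] //; rewrite !addSn !addnS.
apply: next_inj; apply: (card_le1_eqP N1); rewrite !inE prev_next //.
  by rewrite -e eqxx e eq_sym.
by rewrite eqxx eq_sym.
Qed.

(** The copies entered during one full round form a closed walk in the base; it meets every copy,
    and [one_entry] rules out repetitions. *)
Lemma base_hamiltonian : 2 < #|B| -> hamiltonian B.
Proof.
move=> B3; case: cc => s3 /andP[cyc _].
case ec: c s3 => [//|u p] s3; pose D := [seq (next c v).1 | v <- c & out v].
(* The stretch closes up at [u], so that the step back to [u] is recorded too. *)
have fp : fpath (next c) u (rcons p u) by have := cycle_next uc; rewrite {2}ec.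
have /= := trace fp; rewrite belast_rcons -ec -/D last_rcons => -[pD lD sD].
have DT i : i \in D.
  have [x _] : exists x : H, true by exists (port ord0).
  have iD j : j \in u.1 :: D.
    apply: sD; have := cT (j, x); rewrite ec => jc.
    apply/(@mapP _ _ _ (u :: rcons p u)); exists (j, x) => //.
    by rewrite -rcons_cons mem_rcons inE jc orbT.
  have := iD i; rewrite inE => /predU1P[-> |//]; rewrite -lD.
  (* Without any crossing every vertex of the base would equal [u.1], against [2 < #|B|]. Otherwise
     [u.1] ends the closed walk and so occurs in it. *)
  case: (D) iD => [|k D' _]; last by rewrite /= mem_last.
  move=> h; move: B3; rewrite ltnNge; case/negP; apply: leq_trans (leqnSn 1).
  by apply/card_le1_eqP => j k _ _; have := h j; have := h k; rewrite !inE => /eqP -> /eqP.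
exists D; split=> //; rewrite /is_cycle /ucycle.
have uD : uniq D.
  rewrite map_inj_in_uniq ?filter_uniq // => v w; rewrite !mem_filter.
  by move=> /andP[ov _] /andP[ow _]; exact: one_entry.
split; last by rewrite (cycle_path u.1) lD uD andbT.
by rewrite -(card_uniqP uD); apply: leq_trans B3 (subset_leq_card _); apply/subsetP.
Qed.

End NonHamiltonian.

(** * Hamiltonian paths of vertex-deleted inflated graphs *)

Section Traces.
Hypothesis lab_surj : forall i k, exists2 j, adj i j & lab i j = k.
Hypothesis through : forall k l, k != l ->
  exists2 p, spans (port k) p & last (port k) p = port l.

Lemma mem_inside (i : B) (s : seq H) (u : inflate) :
  (u \in map (pair i) s) = (u.1 == i) && (u.2 \in s).
Proof.
case: u => j x; apply/mapP/andP => /= [[y ys [-> ->]]|[/eqP -> xs]] //.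
by exists x.
Qed.

Lemma uniq_inside (i : B) (s : seq H) :
  uniq (map (pair i) s : seq inflate) = uniq s.
Proof. by apply: map_inj_uniq => x y []. Qed.

Lemma path_cat_across (i j : B) (x : H) p q :
  adj i j -> i \notin map fst q -> j != i -> 
  is_path x p -> last x p = port (lab i j) ->
  @is_path inflate (j, port (lab j i)) q ->
  @is_path inflate (i, x) (map (pair i) p ++ (j, port (lab j i)) :: q).
Proof.
move=> aij iq ji [px ux] lp [pq uq]; split.
  rewrite cat_path path_inside px last_map lp; apply/andP; split=> //; apply/andP; split=> //.
  by rewrite adj_across /= 1?eq_sym // aij !eqxx.
rewrite -cat_cons -map_cons cat_uniq uniq_inside ux uq andbT.
apply/hasPn => u; rewrite mem_inside inE => /predU1P[->|/(map_f fst) u1] /=.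
  by rewrite (negbTE ji).
by apply: contra iq => /andP[/eqP <-].
Qed.

(** Each copy on the base path is swept from the port towards the previous copy to the port towards
    the next one. The vertex [i] in front of the path fixes the first entry port. *)
Lemma lift_base_path (i j : B) q :
  adj j i -> path (@adj B) j q -> uniq (i :: j :: q) ->
  exists p, @is_path inflate (j, port (lab j i)) p /\
    forall u, (u \in (j, port (lab j i)) :: p) = (u.1 \in j :: q).
Proof.
elim: q i j => [|j' q IH] i j aji.
  (* In the last copy any exit port other than the entry port will do. *)
  move=> _ _; have [l /through[p [[pp up] pT] _]] : exists l, lab j i != l.
    by case: (lab j i =P ord0) => [->|/eqP]; [exists ord_max | exists ord0].
  exists (map (pair j) p); split.
    by split; rewrite ?path_inside // -map_cons uniq_inside.
  by move=> u; rewrite -map_cons mem_inside pT andbT inE.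
case/andP=> ajj' pq uij; have uj : uniq [:: j, j' & q] by case/andP: uij.
have [|p' [pp' p'T]] := IH j j' _ pq uj; first by rewrite adj_sym.
(* Entry and exit ports differ because the base path does not return to [i]. *)
have ll : lab j i != lab j j'.
  apply: contraL uij => /eqP /(lab_inj aji ajj') ->.
  by rewrite [uniq _]/= !inE eqxx orbT.
have [p [pp pT] lp] := through ll.
exists (map (pair j) p ++ (j', port (lab j' j)) :: p'); split.
  have [jq _] := andP uj.
  have jp' : j \notin map fst ((j', port (lab j' j)) :: p').
    apply: contra jq => /mapP[u up ->]; rewrite -p'T //.
  rewrite inE negb_or eq_sym in jp'; case/andP: jp' => jj' jp'.
  exact: path_cat_across.
move=> u; rewrite -cat_cons mem_cat -map_cons mem_inside pT p'T andbT.
by rewrite [RHS]inE.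
Qed.

(** In the damaged copy the path avoiding [v] stops at a port. The base edge at that port starts a
    spanning path of the base, along which all other copies are swept. *)
Lemma inflate_traceable :
  (forall i j : B, adj i j -> exists q, spans i (j :: q)) ->
  (forall v : H, exists x p k, [/\ is_path x p, last x p = port k
        & forall y, (y \in x :: p) = (y != v)]) ->
  forall v : inflate, traceable (del_vertex v).
Proof.
move=> arcs del [i v]; have [x [p [k [pp lp pv]]]] := del v.
have [j aij ek] := lab_surj i k; have [q [[pq uq] qT]] := arcs i j aij.
have aji : adj j i by rewrite adj_sym.
have [] := @lift_base_path i j q aji _ uq; first by case/andP: pq.
move=> p' [pp' p'T].
have ijq : i \notin j :: q by case/andP: uq.
have ip' : i \notin map fst ((j, port (lab j i)) :: p').
  by apply: contra ijq => /mapP[u up ->]; rewrite -p'T.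
apply: (@traceable_del inflate (i, v) (i, x) (map (pair i) p ++ (j, port (lab j i)) :: p')).
  rewrite inE negb_or eq_sym in ip'; case/andP: ip' => ji ip'.
  by apply: path_cat_across => //; rewrite lp ek.
move=> u; rewrite -cat_cons -map_cons mem_cat mem_inside p'T pv.
have := qT u.1; rewrite inE; case: u => m y /=.
rewrite -[in RHS]pair_eqE /= ; case: eqP => [-> _|_ /= -> //].
by rewrite (negbTE ijq) orbF.
Qed.

End Traces.

(** * Girth of the inflated graph *)

Section Girth.
Variable g : nat.
Hypothesis girthH : has_girth H g.
Hypothesis apart : forall k l p, k != l -> is_path (port k) p ->
  last (port k) p = port l -> g <= (size p).+2.

Lemma last_fix (T : eqType) (x : T) s : uniq (x :: s) -> last x s = x -> s = [::].
Proof. by case: s => //= y s /andP[xs _] e; rewrite -e mem_last in xs. Qed.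

(** The cycle is listed from a vertex at which it enters a copy. Its stretch there joins two
    different ports, so by [apart] it has at least [g - 1] vertices, and at least one more lies
    outside. *)
Lemma entering_cycle (x : inflate) p :
  is_cycle (x :: p) -> (last x p).1 != x.1 -> g <= size (x :: p).
Proof.
case=> s3 /andP[+ ux] zx; rewrite -[path.cycle _ _]/(path _ x (rcons p x)).
rewrite rcons_path => /andP[px azx].
have hp : has (fun u : inflate => u.1 != x.1) p.
  apply/hasP; exists (last x p) => //; move: (mem_last x p).
  by rewrite inE; case/predU1P=> // e; rewrite e eqxx in zx.
(* [x :: s1] is the stretch inside the first copy and [y] the first vertex outside it. *)
case: (split_find hp) s3 ux zx px azx => {hp p} y s1 s2 yx s1x.
rewrite cat_rcons last_cat [last _ (y :: s2)]/= cat_path.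
move=> s3 ux zx /andP[ps1 /andP[ay _]] azx.
have inx : all (fun u => u.1 == x.1) (x :: s1).
  by rewrite /= eqxx -[all _ _]negbK -has_predC.
have lx : (last x s1).1 = x.1 by apply/eqP; exact: (allP inx) (mem_last _ _).
rewrite eq_sym in yx; rewrite eq_sym in zx; rewrite adj_sym in azx.
have := azx; rewrite adj_across // => /and3P[axz /eqP xz _].
have := ay; rewrite adj_across lx // => /and3P[axy /eqP xy _].
(* If the cycle leaves for the copy it came from, it uses the same edge twice and consists of [x]
   and [y] alone, which is too short. *)
have [yz|yz] := eqVneq y.1 (last y s2).1.
  have lxx : last x s1 = x.
    rewrite [RHS]surjective_pairing [LHS]surjective_pairing lx; congr pair.
    by rewrite xy yz -xz.
  rewrite lxx in ay; have yl := across_inj yx zx ay azx.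
  have us : uniq (x :: s1) by move: ux; rewrite -cat_cons cat_uniq => /andP[].
  move: s3 ux; rewrite (last_fix us lxx) => s3 /andP[_ uy].
  by rewrite (last_fix uy) in s3.
have us1 : uniq (x :: s1) by move: ux; rewrite -cat_cons cat_uniq => /andP[].
have es1 := inside_pairs inx; rewrite [x]surjective_pairing /= in es1.
case: es1 => es1; rewrite -/(map snd s1) in es1.
have := @apart (lab x.1 (last y s2).1) (lab x.1 y.1) (map snd s1).
move=> h; apply: leq_trans (h _ _ _) _.
- by apply: contra yz => /eqP/(lab_inj axz axy) ->.
- rewrite -xz; split; first by rewrite -(path_inside x.1) -surjective_pairing -es1.
  by rewrite -(uniq_inside x.1) /= -surjective_pairing -es1.
- by rewrite -xz -xy last_map.
- by rewrite /= size_map size_cat addnS !ltnS leq_addr.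
Qed.

(** A cycle within one copy is a cycle of [H]; any other can be rotated to begin where it enters a
    copy. *)
Lemma inflate_girth : 0 < #|B| -> has_girth inflate g.
Proof.
case: girthH => -[c [[s3 /andP[cc uc]] sg]] gmin /card_gt0P[i _]; split.
  exists (map (pair i) c); split; last by rewrite size_map.
  split; first by rewrite size_map.
  rewrite /ucycle uniq_inside uc andbT; case: (c) cc => //= x p.
  by rewrite -map_rcons path_inside.
move=> {i s3 cc uc sg}c cc.
have [i cin|no_i] := pickP (fun i => all (fun u : inflate => u.1 == i) c).
  rewrite (inside_pairs cin) size_map; apply: gmin.
  move: cc; rewrite {1}(inside_pairs cin) => -[s3 /andP[ac uc]].
  rewrite size_map in s3; rewrite uniq_inside in uc.
  split=> //; rewrite /ucycle uc andbT; case: (map snd c) ac => //= x p.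
  by rewrite -map_rcons path_inside.
case: c cc no_i => [[]//|u p] cc no_i.
have hp : has (fun v : inflate => v.1 != u.1) p.
  rewrite (has_predC (fun v : inflate => v.1 == u.1)).
  by move: (no_i u.1); rewrite /= eqxx /= => ->.
case: (split_find hp) cc {no_i} => {hp} y s1 s2 yu s1u cc.
(* The rotated cycle starts at [y], whose predecessor lies in the copy of [u]. *)
have := is_cycle_rot (size (u :: s1)) cc; rewrite cat_rcons -cat_cons rot_size_cat.
move=> cc'; rewrite size_cat addnC -size_cat; apply: entering_cycle cc' _.
rewrite last_cat /= eq_sym; suff -> : (last u s1).1 = u.1 by [].
have inu : all (fun v => v.1 == u.1) (u :: s1).
  by rewrite /= eqxx -[all _ _]negbK -has_predC.
by apply/eqP; exact: (allP inu) (mem_last _ _).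
Qed.

End Girth.

End Inflation.

Lemma inflate_platypus (g : nat) (B H : sgraph) (port : 'I_3 -> H)
    (lab : B -> B -> 'I_3) :
  fragment g port ->
  (forall i j j', adj i j -> adj i j' -> lab i j = lab i j' -> j = j') ->
  (forall i k, exists2 j, adj i j & lab i j = k) ->
  2 < #|B| -> ~ hamiltonian B ->
  (forall i j : B, adj i j -> exists q, spans i (j :: q)) ->
  platypus (inflate port lab) /\ has_girth (inflate port lab) g.
Proof.
move=> [port_inj gH apart through del] lab_inj lab_surj B3 nB arcs.
split; last by apply: inflate_girth => //; exact: leq_trans B3.
split.
- rewrite card_prod; apply: leq_trans B3 _; rewrite leq_pmulr //.
  by apply/card_gt0P; exists (port ord0).
- by case=> c [cc cT]; apply: nB; exact: base_hamiltonian cc cT B3.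
- exact: inflate_traceable.
Qed.

(** * The Petersen graph *)

(** Outer pentagon 0 to 4, spokes from [i] to [i + 5], and the pentagram 5, 7, 9, 6, 8. Plain
    numbers keep the searches computable. *)
Definition petersen_nbrs : seq (seq nat) :=
  [:: [:: 1; 4; 5]; [:: 0; 2; 6]; [:: 1; 3; 7]; [:: 2; 4; 8]; [:: 0; 3; 9];
      [:: 0; 7; 8]; [:: 1; 8; 9]; [:: 2; 5; 9]; [:: 3; 5; 6]; [:: 4; 6; 7]].

Definition petersen_row (i : nat) : seq nat := nth [::] petersen_nbrs i.

Lemma iota_all2 n (P : rel nat) :
  all (fun i => all (P i) (iota 0 n)) (iota 0 n) -> forall i j : 'I_n, P i j.
Proof.
by move=> /allP h i j; apply: (allP (h i _)); rewrite mem_iota ltn_ord.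
Qed.

Lemma iota_all n (P : pred nat) : all P (iota 0 n) -> forall i : 'I_n, P i.
Proof. by move=> /allP h i; apply: h; rewrite mem_iota ltn_ord. Qed.

Definition petersen_adj : rel 'I_10 := fun i j => (j : nat) \in petersen_row i.

Lemma petersen_sym : symmetric petersen_adj.
Proof.
move=> i j; apply/eqP; move: i j.
exact: (@iota_all2 _ (fun i j => (j \in petersen_row i) == (i \in petersen_row j))).
Qed.

Lemma petersen_irrefl : irreflexive petersen_adj.
Proof.
move=> i; apply/negbTE; move: i.
exact: (@iota_all _ (fun i => i \notin petersen_row i)).
Qed.

Definition petersen : sgraph := SGraph petersen_sym petersen_irrefl.

Lemma petersen_rowP (i : petersen) :
  [/\ uniq (petersen_row i), size (petersen_row i) = 3
    & all (gtn 10) (petersen_row i)].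
Proof.
have := @iota_all 10 (fun i => [&& uniq (petersen_row i), size (petersen_row i) == 3
    & all (gtn 10) (petersen_row i)]) isT i.
by case/and3P=> ? /eqP ? ?.
Qed.

(** A port is the position of the neighbour in the row; at a non-neighbour the value is a dummy. *)
Definition petersen_lab (i j : petersen) : 'I_3 :=
  inord (index (j : nat) (petersen_row i)).

Lemma petersen_lab_inj (i j j' : petersen) :
  adj i j -> adj i j' -> petersen_lab i j = petersen_lab i j' -> j = j'.
Proof.
have [_ s3 _] := petersen_rowP i.
have idx m : m \in petersen_row i -> index m (petersen_row i) < 3.
  by move=> mi; apply: leq_trans (eq_leq s3); rewrite index_mem.
move=> ij ij' /(congr1 (@nat_of_ord _)); rewrite /petersen_lab !inordK.
- by move=> e; apply: val_inj; rewrite /= -(nth_index 0 ij) e nth_index.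
- exact: idx.
- exact: idx.
Qed.

Lemma petersen_lab_surj (i : petersen) (k : 'I_3) :
  exists2 j, adj i j & petersen_lab i j = k.
Proof.
have [ur s3 /allP r10] := petersen_rowP i.
have kr : nth 0 (petersen_row i) k \in petersen_row i by rewrite mem_nth ?s3.
exists (inord (nth 0 (petersen_row i) k) : 'I_10).
  by rewrite /= /petersen_adj inordK //; exact: r10.
apply: val_inj; rewrite /= /petersen_lab (inordK (r10 _ kr)) index_uniq ?s3 //.
by rewrite inordK.
Qed.

(** Depth-first search: [s] holds the visited vertices, [k] counts those still to be added, and [P]
    tests the last one. *)
Fixpoint extend (P : pred nat) (k : nat) (s : seq nat) (x : nat) : bool :=
  if k is k'.+1 then
    has (fun y => (y \notin s) && extend P k' (y :: s) y) (petersen_row x)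
  else P x.

Lemma extendP (P : pred nat) k s x :
  reflect (exists p, [/\ path (fun i j => j \in petersen_row i) x p, size p = k,
             uniq p, all [predC s] p & P (last x p)])
          (extend P k s x).
Proof.
elim: k s x => [|k IH] s x /=.
  apply: (iffP idP) => [Px|[p []]]; first by exists [::].
  by case: p.
apply: (iffP hasP) => [[y xy /andP[ys /IH[p [yp sp up ps Pp]]]]|].
  exists (y :: p); split=> //=; rewrite ?xy ?sp //.
    rewrite up andbT; apply: contraTN ps => yp'; rewrite -has_predC.
    by apply/hasP; exists y; rewrite //= inE eqxx.
  by rewrite ys; apply: sub_all ps => z /=; rewrite inE negb_or => /andP[].
case=> -[[]//|y p [/= /andP[xy yp] [sp] /andP[ynp up] /andP[ys ps] Pp]].
exists y => //; rewrite ys; apply/IH; exists p; split=> //.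
apply/allP => z zp; have := allP ps z zp; rewrite /= inE negb_or => ->; rewrite andbT.
by apply: contraNneq ynp => <-.
Qed.

Lemma petersen_nonhamiltonian : ~ hamiltonian petersen.
Proof.
case=> c [[_ /andP[cc uc]] cT].
have [n p cp] := rot_to (cT (ord0 : 'I_10)).
move: cc uc; rewrite -(rot_cycle n) -(rot_uniq n) cp => cc uc.
have sp : size p = 9.
  apply: succn_inj; rewrite -[LHS]/(size (ord0 :: p)) -(card_uniqP uc) -(card_ord 10).
  by apply: eq_card => i; rewrite -cp mem_rot cT.
(* With the cycle rotated to start at 0, its other nine vertices would be found by the search, which
   evaluates to false. *)
suff : extend (fun y => 0 \in petersen_row y) 9 [:: 0] 0 by vm_compute.
apply/extendP; exists (map val p); move: cc uc => /=.
rewrite rcons_path => /andP[pp lp] /andP[p0 up]; split.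
- by rewrite -[0]/(val (ord0 : 'I_10)) path_map.
- by rewrite size_map.
- by rewrite map_inj_uniq //; exact: val_inj.
- apply/allP => _ /mapP[i ip ->]; rewrite /= inE; apply: contraNneq p0 => i0.
  by rewrite -(_ : i = ord0) //; apply: val_inj.
- by rewrite -[last _ _]/(last (val (ord0 : 'I_10)) _) last_map.
Qed.

(** The search succeeds for each of the thirty directed edges; the numbers it returns have to be
    read back as vertices. *)
Lemma petersen_arcs (i j : petersen) : adj i j -> exists q, spans i (j :: q).
Proof.
move=> ij; have /implyP/(_ ij) := @iota_all2 10 (fun i j => (j \in petersen_row i) ==>
  extend predT 8 [:: j; i] j) isT i j.
case/extendP=> p [pp sp up ps _].
(* Rows beyond the table are empty by default, so the path found stays below 10. *)
have p10 : all (gtn 10) p.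
  elim: p {sp up ps} (j : nat) pp => //= y p IH x /andP[xy /IH ->]; rewrite andbT.
  have [x10|x10] := ltnP x 10; last by rewrite /petersen_row nth_default in xy.
  by have [_ _ /allP] := petersen_rowP (Ordinal x10); apply.
have ep : p = map val (map (@inord 9) p).
  by rewrite -map_comp -[LHS]map_id; apply/eq_in_map => x /(allP p10) xp /=; rewrite inordK.
move: (map _ p) ep => q ep.
have uq : uniq [:: i, j & q].
  rewrite -(map_inj_uniq val_inj) /= -ep up andbT inE negb_or.
  have ip : val i \notin p by apply/negP => /(allP ps); rewrite !inE eqxx orbT.
  have jp : val j \notin p by apply/negP => /(allP ps); rewrite !inE eqxx.
  rewrite ip jp !andbT; apply: contraTN ij => /eqP/val_inj ->.
  by rewrite adj_irrefl.
exists q; split.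
  split=> //; apply/andP; split=> //.
  by rewrite ep path_map in pp.
(* Ten distinct vertices exhaust the graph. *)
have /subset_cardP h : #|[:: i, j & q]| = #|petersen|.
  by rewrite (card_uniqP uq) /= -(size_map val) -ep sp card_ord.
by move=> x; rewrite (h (subset_predT _)).
Qed.

(** * Cubic Cayley graphs *)

Section Cayley.
Local Open Scope group_scope.
Variables (gT : finGroupType) (S : seq gT).
Hypotheses (S1 : 1 \notin S) (SV : forall s, s \in S -> s^-1 \in S).

Definition cayley_adj : rel gT := fun x y => x^-1 * y \in S.

Lemma cayley_sym : symmetric cayley_adj.
Proof.
by move=> x y; apply/idP/idP => /SV; rewrite /cayley_adj invMg invgK.
Qed.

Lemma cayley_irrefl : irreflexive cayley_adj.
Proof. by move=> x; rewrite /cayley_adj mulVg (negbTE S1). Qed.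

Definition cayley : sgraph := SGraph cayley_sym cayley_irrefl.

Definition translate (z x : gT) : gT := z * x.

Lemma cayley_translate z x y :
  cayley_adj (translate z x) (translate z y) = cayley_adj x y.
Proof. by rewrite /cayley_adj invMg -mulgA mulKg. Qed.

Lemma translate_inj z : injective (translate z).
Proof. exact: mulgI. Qed.

Lemma cayley_ucycle_translate z c :
  ucycle cayley_adj (map (translate z) c) = ucycle cayley_adj c.
Proof.
rewrite /ucycle (map_inj_uniq (@translate_inj z)); congr (_ && _).
case: c => //= x p; rewrite -map_rcons path_map.
by apply: eq_path => u v; exact: cayley_translate.
Qed.

Lemma mem_translate z c y : (y \in map (translate z) c) = (z^-1 * y \in c).
Proof. by rewrite -{1}(mulKVg z y) (mem_map (@translate_inj z)). Qed.

(* Deleting [1] is as good as deleting any vertex, because left translations are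
   automorphisms. *)
Lemma cayley_fragment (g : nat) :
  uniq S -> size S = 3 ->
  (forall c, @is_cycle cayley c -> g <= size c) ->
  (exists c, @is_cycle cayley c /\ size c = g) ->
  g < #|gT| ->
  (forall k l : 'I_3, k != l -> exists x p,
    [/\ ucycle cayley_adj [:: x, x * nth 1 S k & p],
        forall y, y \in [:: x, x * nth 1 S k & p]
      & last (x * nth 1 S k) p = x * nth 1 S l]) ->
  (exists2 c, ucycle cayley_adj c & forall y, (y \in c) = (y != 1)) ->
  exists (H : sgraph) (port : 'I_3 -> H), fragment g port.
Proof.
move=> uS sS gmin [c [[c3 uc] cg]] gT_g turns [D uD D1].
have inS (k : 'I_3) : nth 1 S k \in S by rewrite mem_nth ?sS.
have S_n1 (k : 'I_3) : nth 1 S k != 1 by apply: contraNneq S1 => <-.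
pose G := cayley; pose port (k : 'I_3) : del_vertex (1 : G) := Sub (nth 1 S k) (S_n1 k).
have port_inj : injective port.
  move=> k l /(congr1 val) /= /eqP; rewrite nth_uniq ?sS // => /eqP.
  exact: val_inj.
have toport (x : gT) : cayley_adj x 1 -> exists k : 'I_3, x = nth 1 S k.
  rewrite /cayley_adj mulg1 => /SV; rewrite invgK => xS.
  have k3 : index x S < 3 by rewrite -sS index_mem.
  by exists (Ordinal k3); rewrite nth_index.
exists (del_vertex (1 : G)), port; split=> //.
- split; last by move=> s /is_cycle_del/gmin; rewrite size_map.
  (* A shortest cycle misses some [z] because [g < #|gT|]; translation by the inverse of [z] makes
     it avoid 1. *)
  have [z zc] : exists z, z \notin c.
    apply/existsP; rewrite -negb_forall; apply: contraL gT_g => /forallP cT.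
    rewrite -leqNgt -cg; apply: leq_trans (card_size c).
    by apply/subset_leq_card/subsetP => y _; exact: cT.
  have [||q qc cq] := @lift_del_cycle G 1 (map (translate z^-1) c).
  + by split; [rewrite size_map | rewrite cayley_ucycle_translate].
  + by rewrite mem_translate invgK mulg1.
  by exists q; split=> //; rewrite -(size_map val) qc size_map.
(* A path between two ports closes up through 1 to a cycle of the Cayley graph with one vertex
   more. *)
- move=> k l p kl [pp up] lp.
  have p0 : 0 < size p.
    by case: p lp {pp up} => //= /port_inj e; rewrite e eqxx in kl.
  rewrite -(size_map val); apply: (gmin [:: 1, nth 1 S k & map val p]).
  split; first by rewrite /= size_map.
  rewrite /ucycle cons_uniq -[_ :: map val p]/(map val (port k :: p)).
  rewrite (map_inj_uniq val_inj) up andbT; apply/andP; split; last first.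
    by apply/mapP => -[y _ e]; have := valP y; rewrite -e eqxx.
  rewrite /= rcons_path -[nth 1 S k]/(val (port k)) last_map lp path_map [path _ _ _]pp.
  by rewrite /= /cayley_adj invg1 mul1g mulg1 inS SV.
(* Moving [x] to 1 and removing it opens the Hamiltonian cycle into a path from port [k] to port
   [l]. *)
- move=> k l /turns [x [p [uxp xT lp]]].
  have := uxp; rewrite -(cayley_ucycle_translate x^-1) /ucycle /= rcons_path.
  rewrite /translate mulKg mulVg => /andP[/andP[_ /andP[pp _]] /andP[n1 up]].
  have [||q qp pq] := @lift_del_path G 1 (port k) (map (translate x^-1) p).
  + by split.
  + by move: n1; rewrite inE negb_or => /andP[].
  exists q.
    split=> // y; rewrite -(mem_map val_inj) /= qp.
    have := xT (x * val y); rewrite inE -{2}[x]mulg1 (inj_eq (mulgI x)).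
    by rewrite (negbTE (valP y)) /= !inE (inj_eq (mulgI x)) mem_translate invgK.
  apply: val_inj; rewrite -last_map qp /= -[nth 1 S k](mulKg x).
  by rewrite -/(translate x^-1 _) last_map lp /translate mulKg.
(* Translation by [v] turns [D] into a Hamiltonian cycle of the graph without [v]. Cut open at 1, it
   leaves a path whose last vertex is a neighbour of 1, hence a port. *)
- move=> v; have v1 : val v != 1 := valP v.
  pose D' := map (translate (val v)) D.
  have inD' y : (y \in D') = (y != val v).
    by rewrite mem_translate D1 -(inj_eq (mulgI (val v))) mulKVg mulg1.
  have uD' : ucycle cayley_adj D' by rewrite cayley_ucycle_translate.
  have [n p' cp] : rot_to_spec D' 1 by apply: rot_to; rewrite inD' eq_sym.
  have : ucycle cayley_adj (1 :: p') by rewrite -cp /ucycle rot_cycle rot_uniq.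
  case: p' cp => [|x p] cp; first by rewrite /ucycle /= cayley_irrefl.
  case/andP=> /=; rewrite rcons_path => /and3P[_ pp /toport[k lk]] /and3P[np xp up].
  have x1 : x != 1 by apply: contraNneq np => ->; exact: mem_head.
  have [||q qp pq] := @lift_del_path G 1 (Sub x x1) p.
  + by split=> //=; rewrite xp.
  + by move: np; rewrite inE negb_or => /andP[].
  exists (Sub x x1), q, k; split=> //.
    by apply: val_inj; rewrite -last_map qp /= lk.
  move=> y; rewrite -(mem_map val_inj) /= qp -(inj_eq val_inj) -inD'.
  by rewrite -(mem_rot n) cp [in RHS]inE (negbTE (valP y)).
Qed.

End Cayley.

(** * Certificates for permutation groups *)

(** A permutation is the list of its images; [s] acts first, as in products of [{perm 'I_d}]. *)
Definition compose (s t : seq nat) : seq nat := [seq nth 0 t i | i <- s].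

Section PermTables.
Local Open Scope group_scope.
Variable d : nat.

Definition table (p : {perm 'I_d}) : seq nat := [seq val (p i) | i <- enum 'I_d].

Lemma nth_table p (i : 'I_d) : nth 0 (table p) i = p i.
Proof. by rewrite (nth_map i) ?size_enum_ord // nth_ord_enum. Qed.

Lemma table_inj : injective table.
Proof.
by move=> p q e; apply/permP => i; apply: val_inj; rewrite /= -!nth_table e.
Qed.

Lemma table1 : table 1 = iota 0 d.
Proof. by rewrite -val_enum_ord; apply: eq_map => i; rewrite perm1. Qed.

Lemma tableM p q : table (p * q) = compose (table p) (table q).
Proof.
by rewrite /compose -map_comp; apply: eq_map => i; rewrite /= nth_table permM.
Qed.

Lemma table_surj s : perm_eq (iota 0 d) s -> exists p, table p = s.
Proof.
move=> ps; have us : uniq s by rewrite -(perm_uniq ps) iota_uniq.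
have ss : size s = d by rewrite -(perm_size ps) size_iota.
have sd (i : 'I_d) : nth 0 s i < d.
  have : nth 0 s i \in iota 0 d by rewrite (perm_mem ps) mem_nth ?ss.
  by rewrite mem_iota.
have f_inj : injective (fun i => Ordinal (sd i)).
  move=> i j /(congr1 val) /eqP; rewrite /= nth_uniq ?ss // => /eqP.
  exact: val_inj.
exists (perm f_inj); apply: (@eq_from_nth _ 0).
  by rewrite size_map size_enum_ord ss.
move=> i; rewrite size_map size_enum_ord => id.
by rewrite -[i]/(val (Ordinal id)) nth_table permE.
Qed.

(** The generated subgroup is made a group type of its own. By finiteness its elements are products
    of generators without inverses, whence the last clause, by which a finite list is later
    recognised as the whole group. *)
Lemma table_group (T : seq (seq nat)) :
  all (perm_eq (iota 0 d)) T ->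
  exists (gT : finGroupType) (code : gT -> seq nat) (S : seq gT),
    [/\ injective code, code 1 = iota 0 d,
        forall x y, code (x * y) = compose (code x) (code y), map code S = T
      & forall A : {set gT}, 1 \in A ->
          (forall x s, x \in A -> s \in S -> x * s \in A) -> forall x, x \in A].
Proof.
move=> pT; have [S0 eT] : exists S0, map table S0 = T.
  elim: T pT => [|t T IH] /=; first by exists [::].
  by case/andP=> /table_surj[p <-] /IH[S0 <-]; exists (p :: S0).
pose K := <<[set s in S0]>>.
have S0K s : s \in S0 -> s \in K by move=> sS; rewrite mem_gen ?inE.
exists (subg_of K), (table \o sgval), (map (subg K) S0); split.
- by move=> x y /table_inj; exact: val_inj.
- exact: table1.
- by move=> x y; rewrite /= tableM.
- rewrite -map_comp -eT; apply/eq_in_map => s /S0K sK /=.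
  by rewrite subgK.
move=> A A1 AS x; have /gen_prodgP[n [c cS ex]] := valP x.
have {ex} -> : x = \prod_(i < n) subg K (c i).
  apply: val_inj; rewrite ex /= -[LHS]/(\prod_(i < n) c i).
  elim/big_ind2: _ => //= [y y' z z' -> -> // | i _].
  by rewrite subgK // S0K //; have := cS i; rewrite inE.
elim: n c cS => [|n IH] c cS; first by rewrite big_ord0.
rewrite big_ord_recr /=; apply: AS; last first.
  by apply: map_f; have := cS ord_max; rewrite inE.
by apply: (IH (fun i => c (widen_ord (leqnSn n) i))).
Qed.

End PermTables.

(** Since the order is strict, a sorted list has no repetitions; on over a thousand permutations
    this test is much cheaper than [uniq]. *)
Fixpoint lexlt (s t : seq nat) : bool :=
  match s, t with
  | x :: s', y :: t' => if x == y then lexlt s' t' else x < y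
  | [::], _ :: _ => true
  | _, [::] => false
  end.

Lemma lexlt_irrefl : irreflexive lexlt.
Proof. by elim=> //= x s IH; rewrite eqxx. Qed.

Lemma lexlt_trans : transitive lexlt.
Proof.
elim=> [|y t IH] [|x s] [|z u] //=.
case: (ltngtP x y) => [xy|//|<-]; last first.
  by case: (ltngtP x z) => // _; exact: IH.
case: (ltngtP y z) => [yz|//|<-] _ _; last by rewrite (ltn_eqF xy).
by rewrite (ltn_eqF (ltn_trans xy yz)) (ltn_trans xy yz).
Qed.

(** * Computable certificates for fragments of Cayley graphs *)

Section Certificate.
Variables (d : nat) (T : seq (seq nat)).

Let one := iota 0 d.

Definition row (x : seq nat) : seq (seq nat) := map (compose x) T.

Definition step : rel (seq nat) := fun x y => y \in row x.

(** Prefix products of the word [w], whose letters are indices of generators. *)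
Definition tour (x : seq nat) (w : seq nat) : seq (seq nat) :=
  x :: scanl compose x (map (nth [::] T) w).

(* [u] is the vertex visited just before [x]. The conditionals are lazy under
   [vm_compute], unlike [&&] and [||]. *)
Fixpoint no_short_walk (k : nat) (u x : seq nat) : bool :=
  if k is k'.+1 then
    all (fun y => if y == u then true else if y == one then false
                  else no_short_walk k' x y) (row x)
  else true.

(* [c] passes through its first vertex along the generators [k] and [l]. *)
Definition turns (c : seq (seq nat)) (k l : nat) : bool :=
  if c is x :: y :: p then
    (y == compose x (nth [::] T k)) && (last y p == compose x (nth [::] T l))
  else false.

(* The words [c], [e] and [z] spell, without their closing letter, a Hamiltonian
   cycle of the Cayley graph, one of its vertex-deleted subgraph at the identity,
   and a shortest cycle. *)
Definition certificate (g : nat) (c e z : seq nat) : bool :=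
  let C := tour one c in
  let E := tour (nth [::] T 0) e in
  let Z := tour one z in
  [&& [&& all (perm_eq one) T, size T == 3, uniq T, one \notin T
        & all (fun t => one \in row t) T],
      [&& path.cycle step C, sorted lexlt (sort lexlt C)
        & all (fun t => sort lexlt (map (compose^~ t) C) == sort lexlt C) T],
      path.cycle step E && (sort lexlt (one :: E) == sort lexlt C),
      [&& 2 < size Z, path.cycle step Z, uniq Z, size Z == g & g < size C],
      all (no_short_walk (g - 2) one) T
    & all (fun k => all (fun l => (k == l) ||
        has (fun i => turns (rot i C) k l) (iota 0 (size C))) (iota 0 3)) (iota 0 3)].

(** All checks run on lists of images, and [code] carries them over to the group: a tour starts at a
    group element and moves along generators, so each of its vertices is the code of one. *)
Lemma certificate_fragment (g : nat) (c e z : seq nat) :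
  certificate g c e z ->
  exists (H : sgraph) (port : 'I_3 -> H), fragment g port.
Proof.
case/and5P=> /and5P[pT /eqP sT uT T1 TV] /and3P[cC uC CT] /andP[cE EC].
case/and5P=> Z3 cZ uZ /eqP sZ gC /andP[walk turnsC].
have [gT [code [S [code_inj code1 codeM eS genS]]]] := table_group pT.
rewrite -/one in code1.
have sS : size S = 3 by rewrite -sT -eS size_map.
have uS : uniq S by rewrite -(map_inj_uniq code_inj) eS.
have nthT k : k < 3 -> nth [::] T k = code (nth 1%g S k).
  by move=> k3; rewrite -eS (nth_map 1%g) ?sS.
have codeV x y : code (x * y)%g = one -> y = x^-1%g.
  by rewrite -code1 => /code_inj/(canRL (mulKg x)) ->; rewrite mulg1.
have S1 : 1%g \notin S by rewrite -(mem_map code_inj) eS code1.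
have SV s : s \in S -> s^-1%g \in S.
  move=> sS'; have : code s \in T by rewrite -eS map_f.
  move/(allP TV); rewrite /row -eS -map_comp => /mapP[t tS] /=.
  by rewrite -codeM => /esym/codeV <-.
have rowE x : row (code x) = map code [seq (x * s)%g | s <- S].
  by rewrite /row -eS -!map_comp; apply: eq_map => s; rewrite /= codeM.
have stepE x y : step (code x) (code y) = cayley_adj S x y.
  rewrite /step rowE (mem_map code_inj) /cayley_adj -{1}(mulKVg x y).
  by rewrite (mem_map (mulgI x)).
have lift x p : path step (code x) p -> exists q, map code q = p.
  elim: p x => [|y p IH] x /=; first by exists [::].
  rewrite {1}/step rowE => /andP[/mapP[y' _ ->] /IH[q <-]].
  by exists (y' :: q).
have lift_tour x w : path.cycle step (tour (code x) w) ->
    exists2 q, map code (x :: q) = tour (code x) w & path.cycle (cayley_adj S) (x :: q).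
  rewrite /tour => cw; have := cw.
  rewrite /= rcons_path => /andP[/lift[q eq] _]; exists q; rewrite /= ?eq //.
  rewrite -eq /= in cw; move: cw.
  by rewrite -map_rcons path_map; congr is_true; apply: eq_path.
have [C eC cycC] : exists2 q, map code (1%g :: q) = tour one c
    & path.cycle (cayley_adj S) (1%g :: q).
  by rewrite -code1 in cC *; exact: lift_tour.
have [E eE cycE] : exists2 q, map code (nth 1%g S 0 :: q) = tour (nth [::] T 0) e
    & path.cycle (cayley_adj S) (nth 1%g S 0 :: q).
  by rewrite nthT // in cE *; exact: lift_tour.
have [Z eZ cycZ] : exists2 q, map code (1%g :: q) = tour one z
    & path.cycle (cayley_adj S) (1%g :: q).
  by rewrite -code1 in cZ *; exact: lift_tour.
have uCt : uniq (1%g :: C).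
  rewrite -(map_inj_uniq code_inj) eC -(sort_uniq lexlt).
  exact: sorted_uniq lexlt_trans lexlt_irrefl _ uC.
(* The vertices of [C] include 1 and are permuted by right multiplication with each generator, so
   they are the whole group. *)
have CT' x : x \in 1%g :: C.
  pose A := [set x in 1%g :: C].
  suff : x \in A by rewrite inE.
  apply: genS; first by rewrite inE mem_head.
  move=> {}x s; rewrite !inE -!in_cons -!(mem_map code_inj) eC eS codeM => xC sT'.
  rewrite -(mem_sort lexlt) -(eqP (allP CT _ sT')) mem_sort.
  exact: (map_f (compose^~ (code s))).
have ET : perm_eq (1%g :: nth 1%g S 0 :: E) (1%g :: C).
  apply: (perm_map_inj code_inj); rewrite eC /= -/(map code (_ :: E)) eE code1.
  by rewrite -(perm_sort lexlt) (eqP EC) perm_sort.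
(* [k] bounds the steps left for a return from [x] to 1. As the search ignores a step back to [u],
   the case of [x] stepping straight back to [u = 1] is set aside. *)
have walkP k u x p : no_short_walk k (code u) (code x) ->
    size p < k -> uniq [:: u, x & p] -> 1%g \notin x :: p ->
    (p = [::] -> u != 1%g) -> ~~ path (cayley_adj S) x (rcons p 1%g).
  elim: p k u x => [|y p IH] [//|k] u x /=; rewrite rowE => /allP w pk ux x1 u1.
    apply/negP => /andP[x1S _].
    have /w : code 1%g \in map code [seq (x * s)%g | s <- S].
      by rewrite -rowE [_ \in _]stepE.
    rewrite -[one]code1 eqxx; case: eqP => // /code_inj u_1.
    by have := u1 erefl; rewrite -u_1 eqxx.
  apply/negP => /andP[xy]; apply/negP; apply: (IH k x).
  - have /w : code y \in map code [seq (x * s)%g | s <- S].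
      by rewrite -rowE [_ \in _]stepE.
    rewrite -code1 !(inj_eq code_inj); case: eqP => [yu|_].
      by rewrite yu !inE eqxx orbT in ux.
    by case: eqP.
  - exact: pk.
  - by case/andP: ux.
  - by move: x1; rewrite inE negb_or => /andP[].
  - by move=> _; rewrite eq_sym; move: x1; rewrite inE negb_or => /andP[].
apply: (@cayley_fragment gT S S1 SV g) => //.
(* A cycle shorter than [g] is translated to start at 1; its second vertex is then a generator, from
   which at most [g - 2] steps lead back to 1. *)
- move=> [|x0 [|y p]] [] // x3 ux; rewrite leqNgt; apply/negP => xg.
  rewrite -(cayley_ucycle_translate S x0^-1%g) in ux.
  move: ux; rewrite /ucycle /= /translate mulVg => /andP[/andP[yS pp] uyp].
  have yT : code (x0^-1 * y)%g \in T.
    by rewrite -eS (mem_map code_inj); move: yS; rewrite /cayley_adj invg1 mul1g.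
  move: pp; apply/negP/(@walkP (g - 2) 1%g) => //.
  - by rewrite code1; exact: (allP walk).
  - by rewrite size_map ltn_subRL.
  - by case/andP: uyp.
  - by move=> /(congr1 size); rewrite size_map => p0; move: x3; rewrite /= p0.
- exists (1%g :: Z); split; last by rewrite -sZ -eZ size_map.
  split; first by rewrite -eZ size_map in Z3.
  by rewrite /ucycle cycZ -(map_inj_uniq code_inj) eZ.
- apply: leq_trans gC _; rewrite -eC size_map -(card_uniqP uCt).
  exact: max_card.
- move=> k l kl.
  have kl3 (i : 'I_3) : (i : nat) \in iota 0 3 by rewrite mem_iota ltn_ord.
  have := allP (allP turnsC k (kl3 k)) l (kl3 l).
  rewrite (inj_eq (@ord_inj 3)) (negbTE kl) => /hasP[i _].
  rewrite -eC -map_rot.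
  have uR : ucycle (cayley_adj S) (rot i (1%g :: C)).
    by rewrite /ucycle rot_cycle rot_uniq cycC.
  have RT x : x \in rot i (1%g :: C) by rewrite mem_rot.
  case: (rot _ _) uR RT => [|x [|y p]] // uR RT.
  rewrite /= !nthT // -!codeM last_map !(inj_eq code_inj).
  case/andP=> /eqP yk /eqP pl; exists x, p; rewrite -yk; split=> //.
- exists (nth 1%g S 0 :: E).
    by rewrite /ucycle cycE; move: uCt; rewrite -(perm_uniq ET) cons_uniq => /andP[].
  have : uniq (1%g :: nth 1%g S 0 :: E) by rewrite (perm_uniq ET).
  case/andP=> n1 _ y; have := CT' y; rewrite -(perm_mem ET) in_cons.
  by case: eqP => [->|] //= _; rewrite (negbTE n1).
Qed.

End Certificate.

(* Bit 4 tells an ASCII digit from a blank or a line break, which are skipped. *)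
Fixpoint word (s : string) : seq nat :=
  if s is String (Ascii b0 b1 _ _ b4 _ _ _) s' then
    if b4 then b0 + b1.*2 :: word s' else word s'
  else [::].

(** * The fragments *)

(* The groups generated are C6, C8, D5 x C5, S4, D5 x C3, D7 x C3, A5, a group of
   order 100, S5 x C2 (twice), AGL(1,17), PSL(2,8), PGL(2,11), PGL(2,9) x C2. *)

(** An element of order 3, its inverse and a commuting involution give the triangular prism. *)
Lemma fragment_3 : exists (H : sgraph) (port : 'I_3 -> H), fragment 3 port.
Proof.
apply: (@certificate_fragment 5
  [:: [:: 2; 0; 1; 3; 4];
      [:: 1; 2; 0; 3; 4];
      [:: 0; 1; 2; 4; 3]]
  _ (word "00211")
  (word "0200")
  (word "00")).
by vm_compute.
Qed.

(** Translations by 3, 5 and 4 modulo 8; as 3 is a unit, the graph is the Moebius ladder on eight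
    vertices. *)
Lemma fragment_4 : exists (H : sgraph) (port : 'I_3 -> H), fragment 4 port.
Proof.
apply: (@certificate_fragment 8
  [:: [:: 3; 4; 5; 6; 7; 0; 1; 2];
      [:: 5; 6; 7; 0; 1; 2; 3; 4];
      [:: 4; 5; 6; 7; 0; 1; 2; 3]]
  _ (word "2000211")
  (word "020200")
  (word "021")).
by vm_compute.
Qed.

Lemma fragment_5 : exists (H : sgraph) (port : 'I_3 -> H), fragment 5 port.
Proof.
apply: (@certificate_fragment 10
  [:: [:: 2; 3; 4; 0; 1; 8; 9; 5; 6; 7];
      [:: 3; 4; 0; 1; 2; 7; 8; 9; 5; 6];
      [:: 4; 3; 2; 1; 0; 5; 6; 7; 8; 9]]
  _ (word "0020020212112112111121202002021120021211212020000")
  (word "202121121121111202112111121202002021120021211212")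
  (word "0000")).
by vm_compute.
Qed.

Lemma fragment_6 : exists (H : sgraph) (port : 'I_3 -> H), fragment 6 port.
Proof.
apply: (@certificate_fragment 4
  [:: [:: 0; 2; 1; 3];
      [:: 0; 1; 3; 2];
      [:: 2; 3; 0; 1]]
  _ (word "02020201202102020201202")
  (word "1202101202010202012021")
  (word "01010")).
by vm_compute.
Qed.

Lemma fragment_7 : exists (H : sgraph) (port : 'I_3 -> H), fragment 7 port.
Proof.
apply: (@certificate_fragment 8
  [:: [:: 4; 0; 1; 2; 3; 7; 5; 6];
      [:: 1; 2; 3; 4; 0; 6; 7; 5];
      [:: 0; 4; 3; 2; 1; 5; 6; 7]]
  _ (word "20202000202121112121202112002")
  (word "0212020200020200211111200211")
  (word "000021")).
by vm_compute.
Qed.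

Lemma fragment_8 : exists (H : sgraph) (port : 'I_3 -> H), fragment 8 port.
Proof.
apply: (@certificate_fragment 10
  [:: [:: 1; 2; 0; 5; 6; 7; 8; 9; 3; 4];
      [:: 2; 0; 1; 8; 9; 3; 4; 5; 6; 7];
      [:: 0; 1; 2; 4; 3; 9; 8; 7; 6; 5]]
  _ (word "00021112021111121211211120002002020000021")
  (word "2111112120200020211120000002111202000202")
  (word "0002000")).
by vm_compute.
Qed.

Lemma fragment_9 : exists (H : sgraph) (port : 'I_3 -> H), fragment 9 port.
Proof.
apply: (@certificate_fragment 5
  [:: [:: 4; 2; 1; 3; 0];
      [:: 2; 3; 0; 1; 4];
      [:: 3; 4; 2; 0; 1]]
  _ (word "20202121020210202102120202020212020202021201202012020121202")
  (word "2020202012102012120202020210201010212020202102012020101020")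
  (word "01012120")).
by vm_compute.
Qed.

Lemma fragment_10 : exists (H : sgraph) (port : 'I_3 -> H), fragment 10 port.
Proof.
apply: (@certificate_fragment 10
  [:: [:: 3; 4; 0; 1; 2; 6; 9; 7; 5; 8];
      [:: 2; 3; 4; 0; 1; 8; 5; 7; 9; 6];
      [:: 0; 1; 2; 3; 4; 5; 9; 8; 7; 6]]
  _ (word 
    "211111120021200021200202111121111121111121112020211121200212120002002111
     111202002111120211120212002")
  (word 
    "212112120202021212111120202002121202111202121211200200212002021211121202
     11202021121120211202020202")
  (word "000021111")).
by vm_compute.
Qed.

Lemma fragment_11 : exists (H : sgraph) (port : 'I_3 -> H), fragment 11 port.
Proof.
apply: (@certificate_fragment 7
  [:: [:: 2; 1; 0; 3; 4; 6; 5];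
      [:: 0; 3; 4; 1; 2; 6; 5];
      [:: 1; 0; 2; 3; 4; 5; 6]]
  _ (word 
    "101210101010202101212020212012021202120102021201210120210210101012102102
     101020121210202021210120121021202020212120202120202121010121212121210120
     210202102021210101202010202120120212121202020212010202121012120120120120
     21020102010102020102010")
  (word 
    "212120121021210102121010121212120210210101020202020201201210102121010120
     201212121020120120120101210202021010101020210101202120201021010121012021
     012102102020121201210102102021201010120101202102010212120210102120201202
     1201201201201210210102")
  (word "0101012121")).
by vm_compute.
Qed.

Lemma fragment_12 : exists (H : sgraph) (port : 'I_3 -> H), fragment 12 port.
Proof.
apply: (@certificate_fragment 7
  [:: [:: 1; 0; 2; 5; 4; 3; 6];
      [:: 0; 1; 6; 3; 5; 4; 2];
      [:: 0; 1; 2; 6; 4; 5; 3]]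
  _ (word 
    "020201021012102020201202020202102121201021010201020210121012120102121021
     021012101212101212101201212102020212101021212120212121202121212012102102
     121201010210120121021012121201010212010120210202012020201012020120210121
     02020210120201021202121")
  (word 
    "202101021012020120120212010121210101010121202121010201021212102121202121
     010202101021210202121201201012121210102102101210102102010102121012010212
     120201012121021021212121202010212012012101202020121210102120121010201012
     0212120102020201021010")
  (word "01010101010")).
by vm_compute.
Qed.

(** The generators are [6 x + 12], its inverse [3 x + 15] and the involution [13 - x], modulo 17. *)
Lemma fragment_13 : exists (H : sgraph) (port : 'I_3 -> H), fragment 13 port.
Proof.
apply: (@certificate_fragment 17
  [:: [:: 12; 1; 7; 13; 2; 8; 14; 3; 9; 15; 4; 10; 16; 5; 11; 0; 6];
      [:: 15; 1; 4; 7; 10; 13; 16; 2; 5; 8; 11; 14; 0; 3; 6; 9; 12];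
      [:: 13; 12; 11; 10; 9; 8; 7; 6; 5; 4; 3; 2; 1; 0; 16; 15; 14]]
  _ (word 
    "121111111200000020202021121211121200000202120202021212021202002112000200
     021200212111121200002020000200212002112002111211202002021111212020020000
     200000002020020020002020202020212000002021202002020211111211112121121202
     0021211111112021200020212120021202112002112021200202002")
  (word 
    "000021200202111121121200020020021121112112112020211211211211211202121121
     202020020212111111212020021202020211121200020002000000212112002000202021
     121212002121202120020202002121212121112021212112111121211112112111112111
     212111112111112121202021200211212112120020002111202120")
  (word "000000200021")).
by vm_compute.
Qed.

Lemma fragment_14 : exists (H : sgraph) (port : 'I_3 -> H), fragment 14 port.
Proof.
apply: (@certificate_fragment 9
  [:: [:: 1; 0; 6; 3; 7; 8; 2; 4; 5];
      [:: 3; 5; 8; 0; 4; 1; 7; 6; 2];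
      [:: 5; 4; 7; 6; 1; 0; 3; 2; 8]]
  _ (word 
    "012012012121210120121021012121020210201201202010212101212021012020210121
     012121210202120120201202012120202120210212102020212101020210120121201010
     121010210101202021010121202121010210120102020101012121020121202021020120
     121202012021020212121021202121212012102102121212020212120121201202101021
     010210210210210120210212012120121020121010202010101212120102102010212021
     012101021012010212102010210101202121021020120202010201020121021012101201
     02021020101201021210202020102101010101212120102021021012121012121010210")
  (word 
    "101012020102101202012102020202121210102021201201212102121202021212020212
     121210201201202120210201201212020202101021212120212121012120121202102021
     012020121012121202120121012020102020101212010212101012010202021212121010
     102021210121202120210102101020102121212102121210202121020201212101212101
     201202012121210202121201212012121212021210210102120212010212010202102012
     102012020201021202012121010120212101202120210121212121212120210202121010
     1210210102121010202101010210212121210212121210210101021202020120202021")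
  (word "0101020212120")).
by vm_compute.
Qed.

(** With 11 as the point at infinity of the projective line over the field of 11 elements, the
    generators are the involutions [(6 x + 4) / (x - 6)], [4 - x] and [4 / x]. *)
Lemma fragment_15 : exists (H : sgraph) (port : 'I_3 -> H), fragment 15 port.
Proof.
apply: (@certificate_fragment 12
  [:: [:: 3; 9; 7; 0; 8; 10; 11; 2; 4; 1; 5; 6];
      [:: 4; 3; 2; 1; 0; 10; 9; 8; 7; 6; 5; 11];
      [:: 11; 4; 2; 5; 1; 3; 8; 10; 6; 9; 7; 0]]
  _ (word 
    "102121021202020102102101012012021012102020212021010212120202012021210101
     212021212010101201202120121021210102121212121210201010121212021212102020
     102121202021202012120212012012120210201021020102021201210120210120201012
     012101010101212121201021212102012021021012021012020202121212120210212012
     021202010210201212120201210120202012020120102102021012101201210102020202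
     020210121201020101210121202101021210212010202102020102012021212020202102
     120121012121201010120101020212010212010102010120102101201020102121021020
     210102102101210202021020212121201210212102012101201212020102102012020101
     202021012102120101010212021021202121202101202120120120201202012101210120
     102120202020212101020120202101021210210202012102102102012012120201010212
     021210102012121012121020121212120101201010121020201202102010201020121021
     012021201212120102120121010121210120121201202021201202010101020102102102
     102020121201020101212012121010121202012020210202121020201012012102010201
     202101210201021012121020201021210201201020202120101021212020202021020101
     212120201201020120212020212121201012010210210202121201212021202121021010
     120210212021020102021212012101021021201010121201210121021212021201210121
     210101212120212021012021201010201212120202120101201012012102012012120121
     201021012120202021210102012121202020210101020102121202021020212012120120
     12021210201202121020202")
  (word 
    "212121021012020120202021020120210202102121020212102121210102010201010121
     202102101202010212010210210212012012120202010202102121202020201201202012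
     120201202020102102121010121021210212020120121012121210202101021010210212
     021201010212121212101021012010201012021210202101020101210120210121010121
     202020210202010121212021020120120121020102012121202102020102101202020101
     201212101010202101012020210101202012121201202021210121202020202121012020
     102012020121021201212012102021020212101020102012020102121202012121021021
     212101210102020202120120210201012120212101020201020212021201201201012020
     121010201212020210210101020202102102120101020201021201201210202120120101
     210120210212102010101202121201210212010120202010210121202010120121010101
     012020212021012120120212012120101201012020121020121012021010210212020120
     101201201210120210101210102010202102121210210202010201202101012010101202
     120120201012021021010210202021012020210202010202012012010210202102121202
     101010121012021201201021012102102120102010121201201202120202020121021202
     012121202020120212021202120120210120120120121201012121012010120201010101
     202012121021210202101020101210201020202120120201021201212120201202020120
     201201010210212021202021012012120212010101021212010201010121012010102012
     102120212120102101210210102101021012102102120121010102010102102101012121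
     0202101202020202120210")
  (word "01010121202101")).
by vm_compute.
Qed.

Lemma fragment_16 : exists (H : sgraph) (port : 'I_3 -> H), fragment 16 port.
Proof.
apply: (@certificate_fragment 12
  [:: [:: 2; 9; 0; 7; 8; 5; 6; 3; 4; 1; 10; 11];
      [:: 4; 6; 9; 8; 0; 7; 1; 5; 3; 2; 11; 10];
      [:: 4; 5; 2; 3; 0; 1; 8; 9; 6; 7; 11; 10]]
  _ (word 
    "201020120102101202021210201012121020212012012102021201202120201012012012
     010102102120202102102121210121012010120120210201201020120101212010210210
     120101010120202010101202102010102121201020101012021210102101201020102021
     021212120120212021020201201021010201202010120120121020102010201202021201
     202021201202102121021201212121212121020102020202120202020101021202101012
     102101012021201210102021020121010212010201010101021202102121212101020121
     212012101201212021212020101201212102012102021202010212010101212101212012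
     021020101210201201020202101020212120210120212121021210121210210201201210
     120210210201201020210101012101012120102120102120201201201210210201212102
     021210102102102101201202120120101012010121212020121202101201201021210102
     021021212121201210210101202021012121201012010202102012020121212021212120
     102010201010201012012101201212120121010121012010212021210101210121212012
     102102120121210201202102102021021212021201212101012021012120202010210120
     102021212101010102010121212021201212021010202020121020121212020102120120
     201012012121201201202012012102121201012101012120121212010101010102010101
     212020210101212121020202012121212010101020210210121012121020212120201210
     202101010121201210202102101210210120102021202101210210121012121010202020
     202101212121021010120120212020210121210212120210101210212121020120212020
     201210120121020202012010121212021210120101012020101201212010212020202102
     12121201202120102120210210120212021020121201201202102010102121021202012")
  (word 
    "102021020212120210120201212101212020120201212012120201020101010102102021
     010121201201212021201202010101020201202121020201012012120202101201012102
     020120212121201010202012101210201012102102010102120210120102010102020102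
     120202010202012010101210202120202010210102021210120210102012020201012102
     121202101202020210102020120120212012020120102120120210202121021020212101
     210202020101021021212121210120120102101020120102120120120210202021010202
     012120120102020120210202120102012121021212102120202101021021010102012010
     101212010212012012010201210210101010102020212102102021021020201210210212
     021020201210202010201201210102020212020202010120210210101201210212020121
     010101212020120102012101010201202120120121201020210121212101020121201212
     012020102012010120202020212012020102102102020201212120201210102012020212
     120102121212012020120101010210201210201210102102010102120120102101020210
     120202020202121020102010212102021010202020102020101201210202010210212120
     212120212102102020210201021212101020212012020201201202102120102021210102
     101202020121210121021212101012120102020120212101021012120121210101212021
     201012012020212010102120102102102021021210212021012012021020102101201210
     212021202101021210201201212020212121202020210202021201021212020102010210
     201210201210212021201010101202012121012120102020101202021202012010102120
     120201201012021010202010120120210210120202012120121020212021020210101010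
     1010121210202020212021202102010202010120102102102102121210102020102010")
  (word "010102020101020")).
by vm_compute.
Qed.

(** * Platypuses of girth 3 to 16 from the Petersen graph *)

Theorem theorem9 (g : nat) (hg : 3 <= g <= 16) :
  exists G : sgraph, platypus G /\ has_girth G g.
Proof.
have [H [port F]] : exists (H : sgraph) (port : 'I_3 -> H), fragment g port.
  do 3 (case: g hg => [//|g hg]).
  case: g hg => [_|g hg]; first exact: fragment_3.
  case: g hg => [_|g hg]; first exact: fragment_4.
  case: g hg => [_|g hg]; first exact: fragment_5.
  case: g hg => [_|g hg]; first exact: fragment_6.
  case: g hg => [_|g hg]; first exact: fragment_7.
  case: g hg => [_|g hg]; first exact: fragment_8.
  case: g hg => [_|g hg]; first exact: fragment_9.
  case: g hg => [_|g hg]; first exact: fragment_10.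
  case: g hg => [_|g hg]; first exact: fragment_11.
  case: g hg => [_|g hg]; first exact: fragment_12.
  case: g hg => [_|g hg]; first exact: fragment_13.
  case: g hg => [_|g hg]; first exact: fragment_14.
  case: g hg => [_|g hg]; first exact: fragment_15.
  case: g hg => [_|g hg]; first exact: fragment_16.
  by [].
exists (inflate port petersen_lab); apply: inflate_platypus F _ _ _ _ _.
- exact: petersen_lab_inj.
- exact: petersen_lab_surj.
- by rewrite card_ord.
- exact: petersen_nonhamiltonian.
- exact: petersen_arcs.
Qed.
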